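(* Let $f:\mathbb{R}\to\mathbb{R}$ be a smooth, odd, $2\pi$-periodic function with $|f|\le 1$ and with $f(x)\neq 0$ whenever $x$ is not an integer multiple of $\pi$ (e.g. $f(\beta)=\sin\beta$). For all sufficiently small $\epsilon>0$, with perturbation data $\pi=(P,\epsilon,f)$, the perturbed reduced moduli space $R^\natural_\pi(B^3,A_1\cup A_2)$ is homeomorphic to a circle, and the restriction map to the pillowcase $$\rho:R^\natural_\pi(B^3,A_1\cup A_2)\to R(S^2,\{a,b,c,d\})$$ is an immersion, given by $$\rho(\beta)=(\gamma(\beta),\theta(\beta))=\left(\beta+\epsilon f(\beta)+\tfrac{\pi}{2},\ \beta-\epsilon f(\beta)+\tfrac{\pi}{2}\right),\quad \beta\in S^1=\mathbb{R}/2\pi\mathbb{Z}.$$ As $\epsilon\to 0$ this immersion limits to a generically 2-1 map onto the diagonal arc $\gamma=\theta$ in the pillowcase.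
   Context: Notation. $SU(2)$ is identified with the unit quaternions; $C(\mathbf i)=\{x\mathbf i+y\mathbf j+z\mathbf k: x^2+y^2+z^2=1\}$ is the set of pure (traceless) unit quaternions; $e^{tQ}=\cos t+\sin t\,Q$ for $Q\in C(\mathbf i)$. Bars denote inverses in groups and $[x,y]=xy\bar x\bar y$. Pillowcase. $R(S^2,\{a,b,c,d\})$ is the space of conjugacy classes of homomorphisms $\pi_1(S^2\setminus\{a,b,c,d\})=\langle a,b,c,d\mid ba=cd\rangle\to SU(2)$ sending each of $a,b,c,d$ into $C(\mathbf i)$. It is identified with $\mathbb{R}^2/\sim$, where $(\gamma,\theta)\sim(-\gamma,-\theta)\sim(\gamma+2\pi m,\theta+2\pi n)$ for $m,n\in\mathbb{Z}$, by letting $(\gamma,\theta)$ correspond to the class of $a\mapsto\mathbf i,\ b\mapsto e^{\gamma\mathbf k}\mathbf i,\ c\mapsto e^{\theta\mathbf k}\mathbf i,\ d\mapsto e^{(\theta-\gamma)\mathbf k}\mathbf i$. Curves in the pillowcase are described by lifts to $\mathbb{R}^2$. The four images of $(\pi\mathbb{Z})^2$ are the corner points; away from them the pillowcase is a smooth surface, and an immersion into the pillowcase is a map that avoids the corners and is a smooth immersion there. The diagonal arc is the image of $\{(\gamma,\gamma):\gamma\in[0,\pi]\}$. The tangle and the perturbation. $A_1\cup A_2\subset B^3$ is a pair of unknotted arcs in a 3-ball, $H$ is a small meridian circle of $A_1$, $W$ is a short arc joining $H$ and $A_1$, and $P\subset B^3\setminus(A_1\cup A_2\cup H\cup W)$ is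 an unknotted circle linking $A_2$ and $H$. Here $a,b,c,d$ are the meridians of the four endpoints of the arcs (the generators of $\pi_1$ of the 4-punctured boundary sphere), $h,w,p$ are meridians of $H,W,P$, the longitude of $P$ is $\lambda_P=bh$, and $$\pi_1(B^3\setminus(A_1\cup A_2\cup H\cup W\cup P))=\langle a,b,c,d,h,w,p\mid c=\bar p bp,\ d=\bar c ba,\ [bh,p]=1,\ [a\bar p,h]=(ha)w(\bar a\bar h)\rangle.$$ $R^\natural_\pi(B^3,A_1\cup A_2)$ is the space of conjugacy classes of homomorphisms from this group to $SU(2)$ which send $a,b,c,d,h$ into $C(\mathbf i)$, send $w$ to $-1$, and satisfy the perturbation condition: if $\lambda_P\mapsto e^{\beta Q}$ and $p\mapsto e^{\nu Q}$ with $Q\in C(\mathbf i)$, then $\nu=\epsilon f(\beta)$ (i.e. $p\mapsto e^{\epsilon f(\beta)Q}$ whenever $\lambda_P\mapsto e^{\beta Q}$; this is well defined since $f$ is odd and $2\pi$-periodic). The restriction map restricts a representation to $a,b,c,d$. *)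

(* Defs.v *)
From HB Require Import structures.
From mathcomp Require Import all_boot all_order all_algebra generic_quotient.
From mathcomp Require Import all_classical all_reals all_analysis.
From mathcomp Require Import ring.
Import Order.TTheory GRing.Theory Num.Theory.
Import numFieldNormedType.Exports.

Set Implicit Arguments.
Unset Strict Implicit.
Unset Printing Implicit Defensive.

Local Open Scope classical_set_scope.
Local Open Scope ring_scope.
Local Open Scope quotient_scope.

Declare Scope quat_scope.
Delimit Scope quat_scope with quat.
Declare Scope word_scope.
Delimit Scope word_scope with word.

(* (t, x, y, z) stands for t + x i + y j + z k; the topology is that of R^4. *)
Definition quat (R : realType) : Type := (R * R * R * R)%type.

Section Quaternions.
Context {R : realType}.
Implicit Types p q g : quat R.

Definition qmul p q : quat R :=
  let: (t, x, y, z) := p in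
  let: (t', x', y', z') := q in
  (t * t' - x * x' - y * y' - z * z',
   t * x' + x * t' + y * z' - z * y',
   t * y' - x * z' + y * t' + z * x',
   t * z' + x * y' - y * x' + z * t').

(* The quaternionic conjugate, which is the inverse on unit quaternions. *)
Definition qinv q : quat R := let: (t, x, y, z) := q in (t, - x, - y, - z).

Definition qreal (t : R) : quat R := (t, 0, 0, 0).
Definition qi : quat R := (0, 1, 0, 0).
Definition qk : quat R := (0, 0, 0, 1).

Definition SU2 : set (quat R) :=
  [set q | let: (t, x, y, z) := q in t ^+ 2 + x ^+ 2 + y ^+ 2 + z ^+ 2 = 1].

(* The conjugacy class of i in SU(2): the unit quaternions of trace zero *)
Definition Ci : set (quat R) :=
  [set q | let: (t, x, y, z) := q in t = 0 /\ x ^+ 2 + y ^+ 2 + z ^+ 2 = 1].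

(* e^{tQ} = cos t + sin t Q; it is an exponential only for Q in C(i). *)
Definition qexp (t : R) (Q : quat R) : quat R :=
  let: (q0, q1, q2, q3) := Q in
  (cos t + sin t * q0, sin t * q1, sin t * q2, sin t * q3).

End Quaternions.

Notation "p * q" := (qmul p q) : quat_scope.
Notation "q ^-1" := (qinv q) : quat_scope.

Section QuaternionTheory.
Context {R : realType}.
Implicit Types p q g : quat R.

Lemma qmulA p q g : (p * (q * g) = p * q * g)%quat.
Proof.
by case: p q g => [[[? ?] ?] ?] [[[? ?] ?] ?] [[[? ?] ?] ?] /=;
  congr (_, _, _, _); ring.
Qed.

Lemma qmul1q q : (qreal 1 * q = q)%quat.
Proof. by case: q => [[[? ?] ?] ?] /=; congr (_, _, _, _); ring. Qed.

Lemma qmulq1 q : (q * qreal 1 = q)%quat.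
Proof. by case: q => [[[? ?] ?] ?] /=; congr (_, _, _, _); ring. Qed.

Lemma qinvK q : (q^-1^-1 = q)%quat.
Proof. by case: q => [[[? ?] ?] ?] /=; rewrite !opprK. Qed.

Lemma qinvM p q : ((p * q)^-1 = q^-1 * p^-1)%quat.
Proof.
by case: p q => [[[? ?] ?] ?] [[[? ?] ?] ?] /=; congr (_, _, _, _); ring.
Qed.

Lemma qmulqV q : SU2 q -> (q * q^-1 = qreal 1)%quat.
Proof.
by case: q => [[[t x] y] z] /= <-; congr (_, _, _, _); ring.
Qed.

Lemma qmulVq q : SU2 q -> (q^-1 * q = qreal 1)%quat.
Proof.
by case: q => [[[t x] y] z] /= <-; congr (_, _, _, _); ring.
Qed.

Lemma SU2_1 : SU2 (qreal 1 : quat R).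
Proof. by rewrite /SU2 /=; ring. Qed.

Lemma SU2M p q : SU2 p -> SU2 q -> SU2 (p * q)%quat.
Proof.
case: p q => [[[a b] c] d] [[[t x] y] z] /= Hp Hq.
by rewrite -(mulr1 1) -{1}Hp -Hq; ring.
Qed.

Lemma SU2V q : SU2 q -> SU2 (q^-1)%quat.
Proof. by case: q => [[[t x] y] z] /= <-; ring. Qed.

Lemma Ci_SU2 q : Ci q -> SU2 q.
Proof. by case: q => [[[t x] y] z] /= [-> <-]; ring. Qed.

End QuaternionTheory.

Definition elt (T : Type) (A : set T) (x : T) (Ax : A x) : A :=
  exist (fun y => y \in A) x (mem_set Ax).

Inductive word (X : Type) :=
| Gen of X
| One
| Mul of word X & word X
| Inv of word X.
Arguments One {X}.
Notation "u * v" := (Mul u v) : word_scope.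
Notation "u ^-1" := (Inv u) : word_scope.
Definition commw (X : Type) (u v : word X) : word X :=
  (u * v * u^-1 * v^-1)%word.

Section Representations.
Context {R : realType} {X : Type}.

(* {ptws X -> quat R} carries the product topology of (R^4)^X. *)
Local Notation assignment := {ptws X -> quat R}.
Implicit Types x y z : assignment.

Fixpoint eval x (u : word X) : quat R :=
  match u with
  | Gen i => x i
  | One => qreal 1
  | Mul v w => (eval x v * eval x w)%quat
  | Inv v => ((eval x v)^-1)%quat
  end.

(* Homomorphisms <X | u = v for (u, v) in rels> -> SU(2), given by the images *)
(* of the generators.                                                         *)
Definition homs (rels : seq (word X * word X)) : set assignment :=
  [set x | (forall i, SU2 (x i)) /\
           foldr (fun r P => eval x r.1 = eval x r.2 /\ P) True rels].

Definition conjugate (A : set assignment) (x y : A) : bool :=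
  `[< exists2 g : quat R, SU2 g &
        forall i, set_val y i = (g * set_val x i * g^-1)%quat >].

Lemma conjugate_refl (A : set assignment) : reflexive (@conjugate A).
Proof.
move=> x; apply/asboolP; exists (qreal 1); first exact: SU2_1.
move=> i; rewrite qmul1q.
by rewrite -[LHS]qmulq1 /= /qreal !oppr0.
Qed.

Lemma conjugate_imp (A : set assignment) (x y : A) : conjugate x y -> conjugate y x.
Proof.
move=> /asboolP[g gU yE]; apply/asboolP; exists (g^-1)%quat; first exact: SU2V.
move=> i; rewrite yE qinvK !qmulA qmulVq // qmul1q.
by rewrite -qmulA qmulVq // qmulq1.
Qed.

Lemma conjugate_sym (A : set assignment) : symmetric (@conjugate A).
Proof. by move=> x y; apply/idP/idP => /conjugate_imp. Qed.

Lemma conjugate_trans (A : set assignment) : transitive (@conjugate A).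
Proof.
move=> y x z /asboolP[g gU yE] /asboolP[h hU zE]; apply/asboolP.
exists (h * g)%quat; first exact: SU2M.
by move=> i; rewrite zE yE qinvM !qmulA.
Qed.

Canonical conjugate_equiv (A : set assignment) : equiv_rel A :=
  EquivRel (@conjugate A) (@conjugate_refl A) (@conjugate_sym A)
    (@conjugate_trans A).

Definition rep_space (A : set assignment) :=
  quotient_topology {eq_quot (conjugate_equiv A)}.

Definition rep_class (A : set assignment) (x : A) : rep_space A :=
  \pi_(rep_space A) x.

End Representations.

Section Pillowcase.
Context {R : realType}.

Inductive sphere_gen := Sa | Sb | Sc | Sd.

Definition sphere_rels : seq (word sphere_gen * word sphere_gen) :=
  [:: (Gen Sb * Gen Sa, Gen Sc * Gen Sd)%word ].

Definition sphere_reps : set {ptws sphere_gen -> quat R} :=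
  [set x | homs sphere_rels x /\ forall i, Ci (x i)].

Definition pillowcase := rep_space sphere_reps.

Definition pillow_rep (gamma theta : R) : {ptws sphere_gen -> quat R} :=
  fun s => match s with
  | Sa => qi
  | Sb => (qexp gamma qk * qi)%quat
  | Sc => (qexp theta qk * qi)%quat
  | Sd => (qexp (theta - gamma) qk * qi)%quat
  end.

Lemma pillow_repP gamma theta : sphere_reps (pillow_rep gamma theta).
Proof.
have cos2E t : cos t ^+ 2 = 1 - sin t ^+ 2 :> R.
  by rewrite -(cos2Dsin2 t) addrK.
have CiP t : Ci (qexp t qk * qi : quat R)%quat.
  rewrite /Ci /=; split; first by ring.
  by ring: (cos2E t).
have Ci_all s : Ci (pillow_rep gamma theta s).
  by case: s; [split => //=; ring|exact: CiP..].
split=> //; split=> [s|]; first exact: Ci_SU2.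
split=> //=; rewrite !cosB !sinB.
by congr (_, _, _, _); ring: (cos2E theta).
Qed.

(* gamma and theta are coordinates on R^2; pillow_pt is the quotient map by    *)
(* (g, t) ~ (- g, - t) ~ (g + 2 m pi, t + 2 n pi).                             *)
Definition pillow_pt (gamma theta : R) : pillowcase :=
  rep_class (elt (pillow_repP gamma theta)).

Definition corners : set pillowcase :=
  [set u | exists m n : int, u = pillow_pt (m%:~R * pi) (n%:~R * pi)].

Definition diagonal_arc : set pillowcase :=
  [set u | exists2 t : R, 0 <= t <= pi & u = pillow_pt t t].

End Pillowcase.
Arguments pillowcase : clear implicits.
Arguments diagonal_arc : clear implicits.

Section Tangle.
Context {R : realType}.

Inductive tangle_gen := Ta | Tb | Tc | Td | Th | Tw | Tp.

Definition longitudeP : word tangle_gen := (Gen Tb * Gen Th)%word.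

Definition tangle_rels : seq (word tangle_gen * word tangle_gen) :=
  let a := Gen Ta in let b := Gen Tb in let c := Gen Tc in let d := Gen Td in
  let h := Gen Th in let w := Gen Tw in let p := Gen Tp in
  [:: (c, p^-1 * b * p)%word;
      (d, c^-1 * b * a)%word;
      (commw (b * h) p, One)%word;
      (commw (a * p^-1) h, (h * a) * w * (a^-1 * h^-1))%word ].

(* In the last clause the value of the longitude does not determine beta and  *)
(* Q; for f odd and 2 pi-periodic the value required of p does not depend on  *)
(* their choice.                                                              *)
Definition tangle_reps (f : R -> R) (eps : R) :
    set {ptws tangle_gen -> quat R} :=
  [set x | [/\ homs tangle_rels x,
     forall i, i <> Tw -> i <> Tp -> Ci (x i),
     x Tw = qreal (- 1) &
     forall (beta : R) (Q : quat R), Ci Q ->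
       eval x longitudeP = qexp beta Q -> x Tp = qexp (eps * f beta) Q]].

Definition moduli (f : R -> R) (eps : R) := rep_space (tangle_reps f eps).

Definition boundary_gen (s : sphere_gen) : tangle_gen :=
  match s with Sa => Ta | Sb => Tb | Sc => Tc | Sd => Td end.

Lemma restrict_repP f eps (x : {ptws tangle_gen -> quat R}) :
  tangle_reps f eps x ->
  sphere_reps (x \o boundary_gen : {ptws sphere_gen -> quat R}).
Proof.
move=> [[xU [_ [/= xd _]]] xC _ _]; split; last by case; exact: xC.
split=> [s|]; first exact: xU.
by split=> //=; rewrite xd !qmulA qmulqV // qmul1q.
Qed.

Definition restrict_rep f eps (x : tangle_reps f eps) :
    @sphere_reps R :=
  elt (restrict_repP (set_valP x)).

Definition restriction f eps (u : moduli f eps) : pillowcase R :=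
  rep_class (restrict_rep (repr u)).

Lemma restriction_class f eps (x : tangle_reps f eps) :
  restriction (rep_class x) = rep_class (restrict_rep x).
Proof.
rewrite /restriction /rep_class.
have : conjugate (repr (\pi_(moduli f eps) x)) x.
  have /eqmodP : repr (\pi_(moduli f eps) x) = x
    %[mod {eq_quot (conjugate_equiv (tangle_reps f eps))}] by rewrite reprK.
  by [].
move=> /asboolP[g gU gE]; apply/eqmodP/asboolP.
by exists g => // s; exact: gE.
Qed.

End Tangle.

Section Circle.
Context (R : realType).

Definition mod2pi (x y : R) : bool :=
  `[< exists m : int, y = x + m%:~R * (pi *+ 2) >].

Lemma mod2pi_refl : reflexive mod2pi.
Proof. by move=> x; apply/asboolP; exists 0; rewrite mul0r addr0. Qed.

Lemma mod2pi_imp x y : mod2pi x y -> mod2pi y x.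
Proof.
move=> /asboolP[m ->]; apply/asboolP; exists (- m).
by rewrite rmorphN mulNr addrK.
Qed.

Lemma mod2pi_sym : symmetric mod2pi.
Proof. by move=> x y; apply/idP/idP => /mod2pi_imp. Qed.

Lemma mod2pi_trans : transitive mod2pi.
Proof.
move=> y x z /asboolP[m ->] /asboolP[n ->]; apply/asboolP; exists (m + n).
by rewrite rmorphD mulrDl addrA.
Qed.

Canonical mod2pi_equiv : equiv_rel R :=
  EquivRel mod2pi mod2pi_refl mod2pi_sym mod2pi_trans.

Definition circle := quotient_topology {eq_quot mod2pi_equiv}.

Definition angle (beta : R) : circle := \pi_circle beta.

End Circle.

Section Maps.

Definition homeomorphism (T U : topologicalType) (g : T -> U) :=
  continuous g /\ exists2 k : U -> T, continuous k & cancel g k /\ cancel k g.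

Context {R : realType}.

Definition smooth_at (f : R -> R) (x : R) := forall n, derivable (f^`(n))%classic x 1.

Definition smooth (f : R -> R) := forall x, smooth_at f x.

(* Away from the corners, the smooth structure of the pillowcase is the one   *)
(* for which (gamma, theta) |-> pillow_pt gamma theta is a local              *)
(* diffeomorphism, so that smoothness is tested on local lifts to R^2.        *)
Definition pillow_immersion (c : circle R -> pillowcase R) :=
  forall t : R, ~ corners (c (angle t)) /\
    exists gamma theta : R -> R,
      (\forall s \near t, [/\ smooth_at gamma s, smooth_at theta s &
          c (angle s) = pillow_pt (gamma s) (theta s)]) /\
      (gamma^`()%classic t, theta^`()%classic t) <> (0, 0).

(* The exceptional values, without exactly two preimages, are finitely many.  *)
Definition generically_2to1_onto (T U : Type) (g : T -> U) (A : set U) :=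
  range g = A /\ finite_set (A `&` [set u | ~ (g @^-1` [set u] #= `I_2)%card]).

End Maps.

(* Main.v *)
(* With nu = eps * f beta, the relation [a p^-1, h] = -1 says that             *)
(* u = a p^-1 is traceless and orthogonal to h. Write b h = e^(beta Q). If      *)
(* sin beta <> 0 then sin nu <> 0, and tracelessness of b and of a forces Q to  *)
(* be orthogonal to h and to u; if sin beta = 0 then p = 1 and Q can be chosen  *)
(* so. Changing the sign of (beta, Q) if necessary, h = u Q, so the             *)
(* representation is determined by beta and the orthonormal pair (a, Q), which  *)
(* a conjugation moves to (i, k). The traces of b h and of b h a p^-1 h, which  *)
(* are cos beta and sin beta, show that beta modulo 2 pi is an invariant and    *)
(* that the moduli space is Hausdorff; the circle being compact, the            *)
(* parametrization by beta is a homeomorphism.                                  *)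

Require Import Defs.
From HB Require Import structures.
From mathcomp Require Import all_boot all_order all_algebra generic_quotient.
From mathcomp Require Import all_classical all_reals all_analysis.
From mathcomp Require Import ring lra.
Import Order.TTheory GRing.Theory Num.Theory.
Import numFieldNormedType.Exports.

Set Implicit Arguments.
Unset Strict Implicit.
Unset Printing Implicit Defensive.

Local Open Scope classical_set_scope.
Local Open Scope ring_scope.

(** Write nu = eps * f beta. By [tangle_rep_frame] every representation is a [tangle_frame], and by
    [Ci_frame] a conjugation carries its orthonormal pair (a, Q) to (i, k), which gives
    [standard_rep]; [standard_repP] shows that every beta occurs. Since cos beta and sin beta are
    traces of words ([moduli_embedE]), they are continuous conjugacy invariants that recover beta
    modulo 2 pi and separate points. The parametrization is thus a continuous bijection from a
    compact space to a Hausdorff one, to which [compact_homeomorphism] applies.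

    In [standard_rep] the four boundary meridians lie in the plane of i and j, and p acts on it by
    rotation about k; this yields the formula for the restriction ([standard_rep_boundary]). A
    corner on the image would force nu = 0 and cos beta = 0 together, against the assumption on the
    zeros of f. The derivatives of the two coordinates add up to 2, so they never vanish together.

    The formula makes sense at eps = 0 and is jointly continuous in (beta, eps), so compactness
    turns it into compact-open convergence ([restriction_cvg]). The limit runs along the diagonal,
    which the symmetry under (gamma, theta) -> (- gamma, - theta) folds in two
    ([limit_param_fiber]).

    The threshold eps < 1 suffices: with |f| <= 1 it keeps 2 nu in (-2, 2), where the sine vanishes
    only at 0. *)

(** * Angles modulo 2 pi and zeros of the sine *)

Section Trigonometry.
Context {R : realType}.
Implicit Types (x y : R) (g : R -> R).

Lemma periodic_mod2pi (T : zmodType) (g : R -> T) x y :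
  periodic g (pi *+ 2) -> mod2pi x y -> g y = g x.
Proof.
move=> gP /asboolP[m ->].
have gN (n : nat) z : g (z + n%:R * (pi *+ 2)) = g z.
  elim: n z => [|n IH] z; first by rewrite mul0r addr0.
  by rewrite -addn1 natrD mulrDl mul1r addrA gP IH.
case: (intP m) => [|n|n]; first by rewrite mul0r addr0.
  exact: gN.
(* A negative multiple is undone by adding n + 1 full periods. *)
rewrite -(gN n.+1 (x + _)) -addrA; congr (g _).
by rewrite -[RHS]addr0; congr (x + _); rewrite mulrNz mulNr addNr.
Qed.

Lemma mod2pi_reduce x : exists2 y, 0 <= y < pi *+ 2 & mod2pi y x.
Proof.
have p0 : 0 < pi *+ 2 :> R by rewrite mulrn_wgt0 ?pi_gt0.
have /andP[] := Num.Theory.floor_itv (x / (pi *+ 2)).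
set m := Num.floor _; rewrite intrD.
rewrite ler_pdivlMr // ltr_pdivrMr // mulrDl mul1r => m1 m2.
exists (x - m%:~R * (pi *+ 2)).
  by apply/andP; split; lra.
by apply/asboolP; exists m; rewrite subrK.
Qed.

(** For a representative y in [0, 2 pi), the half-angle formula gives sin (y / 2) = 0, whereas this
    sine is positive when 0 < y / 2 < pi. *)
Lemma cos_eq1 x : cos x = 1 -> mod2pi 0 x.
Proof.
have [y /andP[y0 y2] yx] := mod2pi_reduce x.
rewrite (periodic_mod2pi (@cosD2pi R) yx) => cy.
suff <- : y = 0 by [].
move: y0; rewrite le_eqVlt => /predU1P[//|y0].
have : 0 < sin (y / 2) by apply: sin_gt0_pi; lra.
have : cos (y / 2 *+ 2) = 1 by rewrite -mulr_natr divfK ?pnatr_eq0.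
rewrite cos_mulr2n cos2sin2 => h1 h2.
have /eqP : sin (y / 2) ^+ 2 = 0 by lra.
by rewrite sqrf_eq0 => /eqP; lra.
Qed.

Lemma mod2pi_cos_sin x y : cos x = cos y -> sin x = sin y -> mod2pi x y.
Proof.
move=> cE sE; have /cos_eq1/asboolP[m yE] : cos (y - x) = 1.
  by rewrite cosB cE sE -!expr2 cos2Dsin2.
by apply/asboolP; exists m; rewrite -[y](subrK x) yE; ring.
Qed.

Lemma sin_eq0_int x : sin x = 0 -> exists m : int, x = m%:~R * pi.
Proof.
move=> sx; have /cos_eq1/asboolP[m xE] : cos (x *+ 2) = 1.
  by rewrite cos_mulr2n cos2sin2 sx; lra.
by exists m; move: xE; lra.
Qed.

Lemma sin_int_pi (m : int) : sin (m%:~R * pi) = 0 :> R.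
Proof.
have /eqP : sin (m%:~R * pi *+ 2) = 0 :> R.
  rewrite (@periodic_mod2pi _ sin 0) ?sin0 //; first exact: sinD2pi.
  by apply/asboolP; exists m; ring.
have : cos (m%:~R * pi *+ 2) = 1 :> R.
  rewrite (@periodic_mod2pi _ cos 0) ?cos0 //; first exact: cosD2pi.
  by apply/asboolP; exists m; ring.
rewrite cos_mulr2n cos2sin2 => h _.
by apply/eqP; rewrite -sqrf_eq0; apply/eqP; lra.
Qed.

(** The bound 2 is a convenient number below pi, and the sine is positive on (0, 2). *)
Lemma sin_small_eq0 (x : R) : `|x| < 2 -> sin x = 0 -> x = 0.
Proof.
move=> /ltr_normlP[x1 x2] sx; have [||//] := ltgtP x 0 => x0.
  have : 0 < sin (- x) by apply: sin2_gt0; apply/andP; split; lra.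
  by rewrite sinN; lra.
have : 0 < sin x by apply: sin2_gt0; apply/andP; split; lra.
by lra.
Qed.

Lemma mod2piD (s t k : R) : mod2pi s t -> mod2pi (s + k) (t + k).
Proof. by move=> /asboolP[m ->]; apply/asboolP; exists m; rewrite addrAC. Qed.

End Trigonometry.

(** * Conjugation, exponentials and rotations of unit quaternions *)

Section Quaternions.
Context {R : realType}.
Implicit Types (p q g Q u v : quat R) (t : R).

Definition qnorm2 q : R :=
  let: (t, x, y, z) := q in t ^+ 2 + x ^+ 2 + y ^+ 2 + z ^+ 2.

Definition qscale t q : quat R :=
  let: (t', x, y, z) := q in (t * t', t * x, t * y, t * z).

Definition qre q : R := let: (t, _, _, _) := q in t.

Definition qconj g q : quat R := (g * q * g^-1)%quat.

Lemma SU2P q : SU2 q <-> qnorm2 q = 1.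
Proof. by case: q => [[[? ?] ?] ?]. Qed.

Lemma CiP q : Ci q <-> qre q = 0 /\ qnorm2 q = 1.
Proof.
case: q => [[[t x] y] z] /=.
by split=> -[-> <-]; split=> //; rewrite expr0n add0r.
Qed.

Lemma Ci_qi : Ci (qi : quat R). Proof. by split=> //; ring. Qed.
Lemma Ci_qk : Ci (qk : quat R). Proof. by split=> //; ring. Qed.

Lemma qreM p q : qre (p * q)%quat = qre (q * p)%quat.
Proof.
by case: p q => [[[? ?] ?] ?] [[[? ?] ?] ?] /=; ring.
Qed.

Lemma qre_conj g q : SU2 g -> qre (qconj g q) = qre q.
Proof. by move=> gU; rewrite /qconj qreM qmulA qmulVq // qmul1q. Qed.

Lemma qconjM g p q : SU2 g -> qconj g (p * q)%quat = (qconj g p * qconj g q)%quat.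
Proof.
move=> gU; rewrite /qconj -!qmulA; congr (g * (p * _))%quat.
by rewrite (qmulA (g^-1)%quat) qmulVq // qmul1q.
Qed.

Lemma qconjV g q : qconj g (q^-1)%quat = ((qconj g q)^-1)%quat.
Proof. by rewrite /qconj !qinvM qinvK !qmulA. Qed.

Lemma qconj_comp g1 g2 q : qconj (g1 * g2)%quat q = qconj g1 (qconj g2 q).
Proof. by rewrite /qconj qinvM !qmulA. Qed.

Lemma qconj_real g t : SU2 g -> qconj g (qreal t) = qreal t.
Proof.
case: g => [[[a b] c] d] /= gU; rewrite -[in RHS](mulr1 t) -gU /qreal.
by congr (_, _, _, _); ring.
Qed.

Lemma qconj_exp g t Q : SU2 g -> qexp t (qconj g Q) = qconj g (qexp t Q).
Proof.
case: g Q => [[[a b] c] d] [[[q0 q1] q2] q3] /= gU.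
rewrite -(mulr1 (cos t)) -{1}gU.
by congr (_, _, _, _); ring.
Qed.

Lemma SU2_exp t Q : Ci Q -> SU2 (qexp t Q).
Proof.
case: Q => [[[q0 q1] q2] q3] /= [-> QU].
rewrite -(cos2Dsin2 t) -[sin t ^+ 2]mulr1 -QU; ring.
Qed.

(** Real parts give equal cosines, so the sines agree up to sign; if they do not vanish, the
    imaginary parts identify the axes with that same sign. This is the whole ambiguity in the polar
    form that the perturbation condition quantifies over. *)
Lemma eq_qexp s t Q P : Ci Q -> Ci P -> qexp s Q = qexp t P ->
  [\/ sin s = 0 /\ sin t = 0, mod2pi s t /\ Q = P | mod2pi (- s) t /\ P = qscale (-1) Q].
Proof.
case: Q P => [[[q0 q1] q2] q3] [[[p0 p1] p2] p3] /= [-> QU] [-> PU].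
rewrite !mulr0 !addr0 => -[cE e1 e2 e3].
have : (sin s - sin t) * (sin s + sin t) = 0.
  have := cos2Dsin2 s; have := cos2Dsin2 t; rewrite cE => h1 h2.
  by rewrite -subr_sqr; lra.
move/eqP; rewrite mulf_eq0 subr_eq0 addr_eq0 => sE.
have [s0|s0] := eqVneq (sin s) 0.
  constructor 1; split=> //.
  by move: sE; rewrite s0 ![0 == _]eq_sym oppr_eq0 orbb => /eqP.
case/orP: sE => /eqP sE.
  constructor 2; split; first exact: mod2pi_cos_sin.
  by move: e1 e2 e3; rewrite -sE => /(mulfI s0)-> /(mulfI s0)-> /(mulfI s0)->.
constructor 3; split; first by apply: mod2pi_cos_sin; rewrite ?cosN ?sinN ?sE ?opprK.
have tE : sin t = - sin s by rewrite sE opprK.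
move: e1 e2 e3; rewrite tE !mulNr -!mulrN.
move=> /(mulfI s0)-> /(mulfI s0)-> /(mulfI s0)->.
by rewrite !mul1r !opprK.
Qed.

Lemma Ci_conj g q : SU2 g -> Ci q -> Ci (qconj g q).
Proof.
move=> gU /CiP[q0 qU]; apply/CiP; split; first by rewrite qre_conj.
by apply/SU2P; rewrite /qconj; apply: SU2M (SU2V gU); apply: SU2M gU _; apply/SU2P.
Qed.

Lemma sum3_sqr_eq0 (x y z : R) : x ^+ 2 + y ^+ 2 + z ^+ 2 = 0 ->
  [/\ x = 0, y = 0 & z = 0].
Proof.
move/eqP; rewrite !paddr_eq0 ?addr_ge0 ?sqr_ge0 // !sqrf_eq0.
by case/andP=> /andP[/eqP-> /eqP-> /eqP->].
Qed.

Lemma Ci_antipodal u v : Ci u -> Ci v -> qre (u * v)%quat = 1 -> u = qscale (-1) v.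
Proof.
case: u v => [[[u0 u1] u2] u3] [[[v0 v1] v2] v3] /= [-> uU] [-> vU] uv.
have [] : [/\ u1 + v1 = 0, u2 + v2 = 0 & u3 + v3 = 0] by apply: sum3_sqr_eq0; lra.
by move=> *; congr (_, _, _, _); lra.
Qed.

Lemma qexpC s t Q : (qexp s Q * qexp t Q)%quat = (qexp t Q * qexp s Q)%quat.
Proof.
by case: Q => [[[q0 q1] q2] q3] /=; congr (_, _, _, _); ring.
Qed.

Lemma commutator_real p q (t : R) : SU2 p -> SU2 q ->
  (p * q * p^-1 * q^-1)%quat = qreal t <-> (p * q)%quat = (qreal t * (q * p))%quat.
Proof.
move=> pU qU; split=> [<-|->].
  by rewrite -!qmulA (qmulA q^-1%quat) qmulVq // qmul1q qmulVq // qmulq1.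
by rewrite -!qmulA (qmulA p) qmulqV // qmul1q qmulqV // qmulq1.
Qed.

Lemma conj_real_mul p q (t : R) : SU2 p -> SU2 q ->
  (p * q * qreal t * (q^-1 * p^-1))%quat = qreal t.
Proof.
by move=> pU qU; rewrite -qinvM -/(qconj _ _) qconj_real //; exact: SU2M.
Qed.

(* 1 - v u intertwines u with v, and commutes with whatever is orthogonal to  *)
(* both; it vanishes only for v = - u.                                        *)
Lemma Ci_rotation u v : Ci u -> Ci v -> qre (u * v)%quat <> 1 ->
  exists2 g, SU2 g & qconj g u = v /\
    forall w, Ci w -> qre (w * u)%quat = 0 -> qre (w * v)%quat = 0 ->
      qconj g w = w.
Proof.
case: u v => [[[u0 u1] u2] u3] [[[v0 v1] v2] v3] /= [-> uU] [-> vU] uv.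
pose s := u1 * v1 + u2 * v2 + u3 * v3.
have s_gtN1 : 0 < 1 + s.
  rewrite lt_neqAle; apply/andP; split.
    by apply/eqP; rewrite /s => h; apply: uv; lra.
  have := sqr_ge0 (u1 + v1); have := sqr_ge0 (u2 + v2); have := sqr_ge0 (u3 + v3).
  by rewrite /s; lra.
(* [s] is the inner product of u and v, and 1 - v u = (1 + s) + u x v has squared norm 2 (1 + s);
   [r] normalizes it. *)
pose r := (Num.sqrt (2 * (1 + s)))^-1.
have rE : r ^+ 2 * (2 * (1 + s)) = 1.
  rewrite /r exprVn sqr_sqrtr ?mulVf //; first by apply: lt0r_neq0; lra.
  by lra.
pose g : quat R := (r * (1 + s), r * (u2 * v3 - u3 * v2),
  r * (u3 * v1 - u1 * v3), r * (u1 * v2 - u2 * v1)).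
have u1E : u1 ^+ 2 = 1 - u2 ^+ 2 - u3 ^+ 2 by lra.
have v1E : v1 ^+ 2 = 1 - v2 ^+ 2 - v3 ^+ 2 by lra.
have gU : SU2 g by apply: etrans rE; rewrite /s; ring: u1E v1E.
have gP w w' : (g * w = w' * g)%quat -> qconj g w = w'.
  by rewrite /qconj => ->; rewrite -qmulA qmulqV // qmulq1.
exists g => //; split.
  by apply: gP; rewrite /g /s /=; congr (_, _, _, _); ring: u1E v1E.
case=> [[[w0 w1] w2] w3] /= [-> wU] wu wv; apply: gP.
(* Commutation of w with g amounts to w x (u x v) = 0. The orthogonality relations are multiplied by
   the coefficients of the triple product expansion, after which the goal is linear in the
   monomials. *)
have h1 x : (w1 * u1 + w2 * u2 + w3 * u3) * x = 0.
  by rewrite (_ : _ + _ = 0) ?mul0r //; lra.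
have h2 x : (w1 * v1 + w2 * v2 + w3 * v3) * x = 0.
  by rewrite (_ : _ + _ = 0) ?mul0r //; lra.
have := h1 (r * v1); have := h1 (r * v2); have := h1 (r * v3).
have := h2 (r * u1); have := h2 (r * u2); have := h2 (r * u3).
move=> *; rewrite /g /=; congr (_, _, _, _); lra.
Qed.

(** Rotate a to i, then the image of Q to k. The second rotation fixes i because i is orthogonal to
    both its source and its target. [Ci_rotation] excludes antipodal pairs, where conjugation by k,
    respectively by i, does the job. *)
Lemma Ci_frame a Q : Ci a -> Ci Q -> qre (a * Q)%quat = 0 ->
  exists2 g, SU2 g & qconj g a = qi /\ qconj g Q = qk.
Proof.
move=> aC QC aQ.
have [g gU ga] : exists2 g, SU2 g & qconj g a = qi.
  have [/Ci_antipodal -/(_ aC Ci_qi) ->|/Ci_rotation] := pselect (qre (a * qi)%quat = 1).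
    exists qk; first exact: Ci_SU2 Ci_qk.
    by rewrite /qconj /=; congr (_, _, _, _); ring.
  by move=> /(_ aC Ci_qi)[g gU [ga _]]; exists g.
have Q'C := Ci_conj gU QC.
have iQ' : qre (qi * qconj g Q)%quat = 0.
  by rewrite -ga -qconjM // qre_conj.
suff [h hU [hi hQ]] : exists2 h, SU2 h & qconj h qi = qi /\ qconj h (qconj g Q) = qk.
  by exists (h * g)%quat; [exact: SU2M | rewrite !qconj_comp ga].
have [/Ci_antipodal -/(_ Q'C Ci_qk) ->|/Ci_rotation] :=
    pselect (qre (qconj g Q * qk)%quat = 1).
  exists qi; first exact: Ci_SU2 Ci_qi.
  by split; rewrite /qconj /=; congr (_, _, _, _); ring.
move=> /(_ Q'C Ci_qk)[h hU [hQ hw]]; exists h => //; split=> //.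
by apply: hw => //=; [exact: Ci_qi | ring].
Qed.


End Quaternions.

(** * Normal form of a tangle representation *)

Section NormalForm.
Context {R : realType}.
Implicit Types (p q g a u h Q : quat R) (beta nu : R).

(** Here p shares the axis Q of the longitude, h = u Q with u = a p^-1, b is solved from b h =
    e^(beta Q), and c, d come from the first two relators. *)
Definition tangle_frame nu beta a Q : {ptws tangle_gen -> quat R} :=
  let p := qexp nu Q in
  let h := (a * p^-1 * Q)%quat in
  let b := (qexp beta Q * h^-1)%quat in
  let c := (p^-1 * b * p)%quat in
  fun s => match s with
  | Ta => a
  | Tb => b
  | Tc => c
  | Td => (c^-1 * b * a)%quat
  | Th => h
  | Tw => qreal (- 1)
  | Tp => p
  end.

Lemma tangle_frame_conj g nu beta a Q s : SU2 g ->
  tangle_frame nu beta (qconj g a) (qconj g Q) s =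
  qconj g (tangle_frame nu beta a Q s).
Proof.
by move=> gU; case: s; rewrite /= ?qconj_real // ?(qconjM, qconjV, qconj_exp).
Qed.

(** Expanding u h + h u = 0, the imaginary part is the real part u0 of u times h, up to a factor 2,
    and h has norm 1; the real part then gives orthogonality. *)
Lemma Ci_anticommute u h : SU2 u -> Ci h ->
  (u * h = qreal (- 1) * (h * u))%quat -> Ci u /\ qre (u * h)%quat = 0.
Proof.
case: u h => [[[u0 u1] u2] u3] [[[h0 h1] h2] h3] /= uU [-> hU].
rewrite /qreal /= => -[e0 e1 e2 e3].
have z1 : u0 * h1 = 0 by lra.
have z2 : u0 * h2 = 0 by lra.
have z3 : u0 * h3 = 0 by lra.
have u00 : u0 = 0.
  apply/eqP; rewrite -sqrf_eq0 -[_ ^+ 2]mulr1 -hU; apply/eqP.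
  transitivity ((u0 * h1) ^+ 2 + (u0 * h2) ^+ 2 + (u0 * h3) ^+ 2); first by ring.
  by rewrite z1 z2 z3; ring.
split; last by lra.
by split=> //; rewrite -uU u00; ring.
Qed.

Lemma Ci_orthogonal_mul u Q : Ci u -> Ci Q -> qre (u * Q)%quat = 0 -> Ci (u * Q)%quat.
Proof.
move=> /Ci_SU2 uU /Ci_SU2 QU uQ; apply/CiP; split=> //.
by apply/SU2P; exact: SU2M.
Qed.

(** The unit vectors of R^3 orthogonal to u and Q are the two signs of w = u x Q, which is the
    quaternion product u Q here. *)
Lemma Ci_third u Q h : Ci u -> Ci Q -> Ci h ->
  qre (u * Q)%quat = 0 -> qre (u * h)%quat = 0 -> qre (Q * h)%quat = 0 ->
  h = (u * Q)%quat \/ h = (u * qscale (-1) Q)%quat.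
Proof.
move=> uC QC hC uQ; have := Ci_orthogonal_mul uC QC uQ.
case: u Q h uC QC hC uQ => [[[u0 u1] u2] u3] [[[q0 q1] q2] q3] [[[h0 h1] h2] h3].
move=> /= [-> uU] [-> QU] [-> hU] uQ [_ wU] uh Qh.
set w1 := (X in X ^+ 2 + _ + _ = 1) in wU.
set w2 := (X in _ + X ^+ 2 + _ = 1) in wU.
set w3 := (X in _ + _ + X ^+ 2 = 1) in wU.
have uh' x : (u1 * h1 + u2 * h2 + u3 * h3) * x = 0.
  by rewrite (_ : _ + _ = 0) ?mul0r //; lra.
have Qh' x : (q1 * h1 + q2 * h2 + q3 * h3) * x = 0.
  by rewrite (_ : _ + _ = 0) ?mul0r //; lra.
(* The triple product expansion of h x (u x Q) has coefficients h.u and h.Q, so h x w = 0 and h is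
   the multiple [s] of w. *)
have c1 : h2 * w3 - h3 * w2 = 0.
  by have := uh' q1; have := Qh' u1; rewrite /w2 /w3 => *; lra.
have c2 : h3 * w1 - h1 * w3 = 0.
  by have := uh' q2; have := Qh' u2; rewrite /w1 /w3 => *; lra.
have c3 : h1 * w2 - h2 * w1 = 0.
  by have := uh' q3; have := Qh' u3; rewrite /w1 /w2 => *; lra.
pose s := h1 * w1 + h2 * w2 + h3 * w3.
have h1E : h1 = s * w1.
  rewrite -[LHS]mulr1 -wU.
  transitivity (s * w1 + w2 * (h1 * w2 - h2 * w1) - w3 * (h3 * w1 - h1 * w3)).
    by rewrite /s; ring.
  by rewrite c2 c3; ring.
have h2E : h2 = s * w2.
  rewrite -[LHS]mulr1 -wU.
  transitivity (s * w2 + w3 * (h2 * w3 - h3 * w2) - w1 * (h1 * w2 - h2 * w1)).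
    by rewrite /s; ring.
  by rewrite c1 c3; ring.
have h3E : h3 = s * w3.
  rewrite -[LHS]mulr1 -wU.
  transitivity (s * w3 + w1 * (h3 * w1 - h1 * w3) - w2 * (h2 * w3 - h3 * w2)).
    by rewrite /s; ring.
  by rewrite c1 c2; ring.
have /eqP : s ^+ 2 = 1.
  have := hU; rewrite h1E h2E h3E => <-.
  by rewrite -[LHS]mulr1 -wU; ring.
rewrite sqrf_eq1 => /orP[] /eqP sE; [left|right];
  rewrite h1E h2E h3E sE /w1 /w2 /w3; congr (_, _, _, _); lra.
Qed.

(** The axis is the normalized imaginary part. Where that part vanishes every axis serves, and the
    prescribed [Q0] leaves the choice to the caller. *)
Lemma SU2_polar q Q0 : SU2 q -> Ci Q0 ->
  exists beta Q, [/\ Ci Q, q = qexp beta Q & sin beta = 0 -> Q = Q0].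
Proof.
case: q => [[[t x] y] z] /= qU Q0C.
have t1 : -1 <= t <= 1.
  have := sqr_ge0 x; have := sqr_ge0 y; have := sqr_ge0 z.
  by move=> *; apply/andP; split; nra.
have ct : cos (acos t) = t by rewrite acosK // in_itv.
have sct := cos2Dsin2 (acos t); rewrite ct in sct.
exists (acos t); have [s0|s0] := eqVneq (sin (acos t)) 0.
  exists Q0; split=> //.
  have [] : [/\ x = 0, y = 0 & z = 0].
    by apply: sum3_sqr_eq0; rewrite s0 in sct; lra.
  case: Q0 Q0C => [[[q0 q1] q2] q3] [-> _] -> -> -> /=.
  by rewrite ct s0 !mul0r addr0.
set s := sin _ in s0 sct *.
exists (0, x / s, y / s, z / s); split.
- split=> //; rewrite !expr_div_n -!mulrDl.
  rewrite (_ : x ^+ 2 + _ + _ = s ^+ 2) ?divff ?sqrf_eq0 //; lra.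
- rewrite /= -/s ct mulr0 addr0.
  by congr (_, _, _, _); rewrite mulrC divfK.
- by move=> s0'; rewrite s0' eqxx in s0.
Qed.

(** As u is traceless, the cosine term contributes nothing to the real part, and sin t can be
    cancelled from the rest. *)
Lemma qre_mul_exp u t Q : Ci u -> Ci Q -> sin t <> 0 ->
  qre (u * qexp t Q)%quat = 0 -> qre (u * Q)%quat = 0.
Proof.
case: u Q => [[[u0 u1] u2] u3] [[[q0 q1] q2] q3] [-> _] [-> _] /eqP st /= e.
by apply: (mulfI st); lra.
Qed.

Lemma qre_mul_exp_axis u t Q : Ci u -> Ci Q -> qre (u * Q)%quat = 0 ->
  qre (u * qexp t Q * Q)%quat = 0.
Proof.
case: u Q => [[[u0 u1] u2] u3] [[[q0 q1] q2] q3] [-> _] [-> _] /= e.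
transitivity (cos t * (0 * 0 - u1 * q1 - u2 * q2 - u3 * q3)); first by ring.
by rewrite e mulr0.
Qed.

Lemma qre_exp_mulV h t Q : Ci Q -> Ci h -> sin t <> 0 ->
  qre (qexp t Q * h^-1)%quat = 0 -> qre (Q * h)%quat = 0.
Proof.
case: h Q => [[[h0 h1] h2] h3] [[[q0 q1] q2] q3] [-> _] [-> _] /eqP st /= e.
by apply: (mulfI st); lra.
Qed.

Lemma qre_mulKl u h : Ci u -> Ci h -> qre (u * (u * h))%quat = 0.
Proof.
case: u h => [[[u0 u1] u2] u3] [[[h0 h1] h2] h3] [-> _] [-> _] /=; ring.
Qed.

Lemma qre_mulKr u h : Ci u -> Ci h -> qre (u * h * h)%quat = 0.
Proof.
case: u h => [[[u0 u1] u2] u3] [[[h0 h1] h2] h3] [-> _] [-> _] /=; ring.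
Qed.

Lemma tangle_frame_eq (x : {ptws tangle_gen -> quat R}) nu beta Q :
  x Tp = qexp nu Q -> x Th = (x Ta * (x Tp)^-1 * Q)%quat ->
  x Tb = (qexp beta Q * (x Th)^-1)%quat ->
  x Tc = ((x Tp)^-1 * x Tb * x Tp)%quat ->
  x Td = ((x Tc)^-1 * x Tb * x Ta)%quat -> x Tw = qreal (- 1) ->
  forall s, x s = tangle_frame nu beta (x Ta) Q s.
Proof.
move=> pE hE bE cE dE wE; rewrite pE in hE cE.
rewrite cE in dE; rewrite bE in cE dE; rewrite hE in bE cE dE.
case; [exact: erefl|exact: bE|exact: cE|exact: dE|exact: hE|exact: wE|exact: pE].
Qed.

End NormalForm.

(** * The perturbation condition and the classification of representations *)

Section Perturbation.
Context {R : realType} (f : R -> R).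
Hypothesis f_odd : forall x : R, f (- x) = - f x.
Hypothesis f_periodic : periodic f (pi *+ 2).
Implicit Types (p q g a u h Q : quat R) (beta eps : R).

(** The points m pi and - m pi agree modulo 2 pi, where f takes opposite values by oddness. *)
Lemma odd_periodic_eq0 beta : sin beta = 0 -> f beta = 0.
Proof.
move=> /sin_eq0_int[m ->].
have : f (m%:~R * pi) = f (- (m%:~R * pi)).
  apply: periodic_mod2pi => //; apply/asboolP; exists m; ring.
by rewrite f_odd; lra.
Qed.

Definition standard_rep eps beta := tangle_frame (eps * f beta) beta (qi : quat R) qk.

(** Since i e^(nu k) = e^(- nu k) i, both factors e^(- nu k) collect on the left. *)
Lemma planar_conj (nu t : R) :
  ((qexp nu qk)^-1 * (qexp t qk * qi) * qexp nu qk)%quat =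
  (qexp (t - nu *+ 2) qk * qi)%quat :> quat R.
Proof.
have nE := cos2sin2 nu.
rewrite mulr2n opprD addrA /= !(cosB, sinB); congr (_, _, _, _); ring: nE.
Qed.

Lemma planar_div (s t : R) :
  ((qexp s qk * qi)^-1 * (qexp t qk * qi) * qi)%quat =
  (qexp (s - t) qk * qi)%quat :> quat R.
Proof. by rewrite /= cosB sinB; congr (_, _, _, _); ring. Qed.

(** Here h = - e^(nu k) j, hence b = e^((beta + nu) k) j. As j = k i and k = e^(pi/2 k), this is the
    source of the shift by pi / 2; conjugation by p then lowers the angle by 2 nu for c. *)
Lemma standard_rep_boundary eps beta :
  standard_rep eps beta \o boundary_gen =
  pillow_rep (beta + eps * f beta + pi / 2) (beta - eps * f beta + pi / 2).
Proof.
set nu := eps * f beta; have nE := cos2sin2 nu.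
have bE : standard_rep eps beta Tb = (qexp (beta + nu + pi / 2) qk * qi)%quat.
  rewrite /standard_rep -/nu /= cosDpihalf sinDpihalf cosD sinD.
  by congr (_, _, _, _); ring.
have cE : standard_rep eps beta Tc = (qexp (beta - nu + pi / 2) qk * qi)%quat.
  rewrite -[LHS]/((qexp nu qk)^-1 * standard_rep eps beta Tb * qexp nu qk)%quat.
  by rewrite bE planar_conj; congr (qexp _ _ * _)%quat; ring.
apply/funext; case; rewrite /comp /boundary_gen; [by []|exact: bE|exact: cE|].
rewrite -[LHS]/((standard_rep eps beta Tc)^-1 * standard_rep eps beta Tb * qi)%quat.
by rewrite bE cE planar_div.
Qed.

Lemma standard_repP eps beta : tangle_reps f eps (standard_rep eps beta).
Proof.
set nu := eps * f beta.
have nE := cos2sin2 nu.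
have pU : SU2 (qexp nu (qk : quat R)) := SU2_exp nu Ci_qk.
have aC : Ci (standard_rep eps beta Ta) by exact: Ci_qi.
have hC : Ci (standard_rep eps beta Th).
  by rewrite /standard_rep -/nu /=; split; ring: nE.
have boundaryC s : Ci (standard_rep eps beta (boundary_gen s)).
  rewrite -[standard_rep _ _ _]/((standard_rep eps beta \o boundary_gen) s).
  by rewrite standard_rep_boundary; exact: (pillow_repP _ _).2.
have bC := boundaryC Sb; have cC := boundaryC Sc; have dC := boundaryC Sd.
have bhE : Defs.eval (standard_rep eps beta) longitudeP = qexp beta (qk : quat R).
  pose h := standard_rep eps beta Th.
  rewrite -[LHS]/(qexp beta (qk : quat R) * h^-1 * h)%quat -qmulA.
  by rewrite qmulVq ?qmulq1; last exact: Ci_SU2.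
split.
- split.
    case; [exact: Ci_SU2..| |exact: pU].
    by rewrite /SU2 /=; ring.
  split; first exact: erefl.
  split; first exact: erefl.
  split.
    pose L := Defs.eval (standard_rep eps beta) longitudeP.
    rewrite -[LHS]/(L * qexp nu (qk : quat R) * L^-1 * (qexp nu qk)^-1)%quat.
    apply/(commutator_real _ _ pU); first by rewrite /L bhE; exact: SU2_exp Ci_qk.
    by rewrite /L bhE qmul1q qexpC.
  split; last exact: I.
  pose a := standard_rep eps beta Ta; pose h := standard_rep eps beta Th.
  pose u := (a * (qexp nu (qk : quat R))^-1)%quat.
  rewrite -[LHS]/(u * h * u^-1 * h^-1)%quat.
  rewrite -[RHS]/(h * a * qreal (-1) * (a^-1 * h^-1))%quat.
  rewrite conj_real_mul; [|exact: Ci_SU2..].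
  apply/commutator_real; [|exact: Ci_SU2|].
    by apply: SU2M (SU2V pU); exact: Ci_SU2.
  by rewrite /h /u /a /standard_rep -/nu /qreal /=; congr (_, _, _, _); ring: nE.
- case=> hw hp; [exact: aC|exact: bC|exact: cC|exact: dC|exact: hC| |].
    by case: hw.
  by case: hp.
- exact: erefl.
(* Independence of the polar form: f vanishes at both angles and p = 1, or the angles agree modulo 2
   pi, or angle and axis both change sign and oddness of f compensates. *)
- move=> t Q QC; rewrite bhE => /eq_qexp-/(_ Ci_qk QC) [[s0 t0]|[st <-]|[st ->]].
  + rewrite -[LHS]/(qexp nu (qk : quat R)) /nu (odd_periodic_eq0 s0).
    rewrite (odd_periodic_eq0 t0) mulr0.
    by case: Q QC => [[[q0 q1] q2] q3] _; rewrite /qexp /= cos0 sin0 !mul0r.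
  + by rewrite (periodic_mod2pi f_periodic st).
  + rewrite (periodic_mod2pi f_periodic st) f_odd mulrN -/nu.
    rewrite -[LHS]/(qexp nu (qk : quat R)).
    by rewrite /qexp /qk /qscale cosN sinN; congr (_, _, _, _); ring.
Qed.

Lemma standard_rep_mod2pi eps s t : mod2pi s t ->
  standard_rep eps s = standard_rep eps t.
Proof.
move=> st; rewrite /standard_rep (periodic_mod2pi f_periodic st) /tangle_frame.
have -> // : qexp s (qk : quat R) = qexp t qk.
by rewrite /qexp (periodic_mod2pi (@cosD2pi R) st) (periodic_mod2pi (@sinD2pi R) st).
Qed.

Hypothesis f_le1 : forall x : R, `|f x| <= 1.
Hypothesis f_neq0 : forall x : R, (forall m : int, x <> m%:~R * pi) -> f x <> 0.

(** Used with k = 1 to see that sin nu is nonzero, and with k = 2 to keep the image off the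
    corners. *)
Lemma normM_small eps k beta : 0 < eps < 1 -> `|k| <= 2 -> `|k * (eps * f beta)| < 2.
Proof.
move=> /andP[e0 e1] k2; rewrite !normrM (gtr0_norm e0).
have := f_le1 beta; have := normr_ge0 (f beta) => *.
have y1 : eps * `|f beta| < 1 by nra.
have y0 : 0 <= eps * `|f beta| by nra.
by apply: le_lt_trans (ler_wpM2r y0 k2) _; lra.
Qed.

Lemma perturbation_neq0 eps beta : 0 < eps < 1 -> sin beta <> 0 ->
  sin (eps * f beta) <> 0.
Proof.
move=> eE sb se; have /f_neq0 f0 : forall m : int, beta <> m%:~R * pi.
  by move=> m bE; apply: sb; rewrite bE sin_int_pi.
have /eqP : eps * f beta = 0.
  apply: sin_small_eq0 => //; rewrite -[_ * _]mul1r.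
  by apply: normM_small => //; rewrite normr1; lra.
by rewrite mulf_eq0 => /orP[] /eqP //; move/andP: eE => [? _]; lra.
Qed.

Lemma tangle_rep_frame eps (x : {ptws tangle_gen -> quat R}) :
  0 < eps < 1 -> tangle_reps f eps x ->
  exists beta, exists a, exists Q, [/\ Ci a, Ci Q, qre (a * Q)%quat = 0 &
    forall s, x s = tangle_frame (eps * f beta) beta a Q s].
Proof.
move=> eE [[xU [xc [xd [_ [xh _]]]]] xC xw xp].
have xcE : x Tc = ((x Tp)^-1 * x Tb * x Tp)%quat := xc.
have xdE : x Td = ((x Tc)^-1 * x Tb * x Ta)%quat := xd.
have aC : Ci (x Ta) by exact: xC.
have bC : Ci (x Tb) by exact: xC.
have hC : Ci (x Th) by exact: xC.
set u := (x Ta * (x Tp)^-1)%quat.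
have uU : SU2 u by apply: SU2M; [exact: xU | exact: SU2V].
(* The right side of the last relator is a conjugate of w = -1, so u and h anticommute. *)
have [uC uh] : Ci u /\ qre (u * x Th)%quat = 0.
  apply: Ci_anticommute => //; apply/commutator_real => //.
  rewrite -(conj_real_mul (-1) (xU Th) (xU Ta)) -xw; exact: xh.
(* If b h is 1 or -1, the axis is taken to be u h, which is orthogonal to both u and h. *)
have [beta [Q [QC bhE Qsin]]] :=
  SU2_polar (SU2M (xU Tb) (xU Th)) (Ci_orthogonal_mul uC hC uh).
have pE := xp _ _ QC bhE.
have bE : x Tb = (qexp beta Q * (x Th)^-1)%quat.
  by rewrite -bhE -qmulA qmulqV ?qmulq1.
have aE : x Ta = (u * qexp (eps * f beta) Q)%quat.
  by rewrite -pE /u -qmulA qmulVq ?qmulq1.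
(* Otherwise tracelessness of a = u e^(nu Q) and of b = e^(beta Q) h^-1 gives the two orthogonality
   relations. *)
have [uQ Qh] : qre (u * Q)%quat = 0 /\ qre (Q * x Th)%quat = 0.
  have [/Qsin ->|sb] := pselect (sin beta = 0).
    by split; [exact: qre_mulKl | exact: qre_mulKr].
  split.
    apply: (qre_mul_exp uC QC (perturbation_neq0 eE sb)).
    by rewrite -aE; case/CiP: aC.
  apply: (qre_exp_mulV QC hC sb).
  by rewrite -bE; case/CiP: bC.
have [hE|hE] := Ci_third uC QC hC uQ uh Qh.
  exists beta, (x Ta), Q; split=> //; first by rewrite aE qre_mul_exp_axis.
  exact: tangle_frame_eq.
(* The case h = - u Q is absorbed by replacing (beta, Q) with (- beta, - Q), which preserves b h
   and, by oddness of f, the value of p. *)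
pose Q' := qscale (-1) Q.
have expN t : qexp t Q = qexp (- t) Q'.
  by rewrite /Q'; case: (Q) => [[[q0 q1] q2] q3] /=; rewrite cosN sinN;
    congr (_, _, _, _); ring.
have [Q'C uQ'] : Ci Q' /\ qre (u * Q')%quat = 0.
  move: QC uQ uC; rewrite /Q'; case: (Q) (u) => [[[q0 q1] q2] q3] [[[u0 u1] u2] u3] /=.
  by move=> [-> QU] e [-> _]; split; [split; [ring|apply: etrans QU; ring] | lra].
exists (- beta), (x Ta), Q'; rewrite f_odd mulrN; split=> //.
  by rewrite aE expN qre_mul_exp_axis.
by apply: tangle_frame_eq => //; rewrite -expN.

Qed.

End Perturbation.

(** * Continuity tools for assignments and quaternions *)

Section ContinuityTools.

Lemma ptws_continuous (T : topologicalType) (X : Type) (Y : topologicalType)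
    (F : T -> {ptws X -> Y}) :
  (forall i, continuous (fun t => F t i)) -> continuous F.
Proof.
move=> Fc t; apply/cvg_sup => i.
move: t; apply/(@continuousP _ (initial_topology (@^~ i))) => A [B oB <-].
by move/continuousP: (Fc i); exact.
Qed.

Lemma ptws_proj_continuous (X : Type) (Y : topologicalType) (i : X) :
  continuous (fun x : {ptws X -> Y} => x i).
Proof.
move=> x; have /cvg_sup/(_ i) xi : nbhs x --> x by exact: cvg_id.
by move=> A /(@initial_continuous _ _ (@^~ i)); exact: xi.
Qed.

Lemma set_val_continuous (T : topologicalType) (A : set T) :
  continuous (set_val : A -> T).
Proof. exact: initial_continuous. Qed.

Lemma elt_continuous (T U : topologicalType) (A : set U) (F : T -> U)
    (AF : forall t, A (F t)) :
  continuous F -> continuous (fun t => elt (AF t)).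
Proof.
move=> /continuousP Fc; apply/continuousP => _ [B oB <-].
by rewrite -comp_preimage; exact: Fc.
Qed.

Lemma injective_hausdorff (T U : topologicalType) (j : T -> U) :
  hausdorff_space U -> continuous j -> injective j -> hausdorff_space T.
Proof.
move=> hU jc jI p q pq; apply: jI; apply: hU => A B /jc pA /jc qB.
by have [t [/= At Bt]] := pq _ _ pA qB; exists (j t).
Qed.

(** Images of closed sets are compact, hence closed, so the inverse is continuous. *)
Lemma compact_homeomorphism (T U : topologicalType) (F : T -> U) :
  compact [set: T] -> hausdorff_space U -> continuous F -> injective F ->
  (forall u, exists t, F t = u) -> homeomorphism F.
Proof.
move=> Tc hU Fc FI /choice[k kK]; split=> //.
have FK : cancel F k by move=> t; apply: FI; rewrite kK.
exists k => //; apply/continuous_closedP => A cA.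
rewrite (_ : k @^-1` A = F @` A).
  apply: compact_closed => //; apply: continuous_compact.
    exact: continuous_subspaceT.
  exact: subclosed_compact cA Tc _.
by apply/seteqP; split=> [u Au|_ [t At <-]] /=; [exists (k u)|rewrite FK].
Qed.

End ContinuityTools.

Section QuaternionContinuity.
Context {R : realType} {T : topologicalType}.
Implicit Types (F G : T -> quat R).

Lemma quat_continuous (a b c d : T -> R) :
  continuous a -> continuous b -> continuous c -> continuous d ->
  continuous (fun t => (a t, b t, c t, d t) : quat R).
Proof.
move=> ac bc cc dc t.
exact: (cvg_pair (cvg_pair (cvg_pair (ac t) (bc t)) (cc t)) (dc t)).
Qed.

Lemma qcoord_continuous (F : T -> quat R) : continuous F ->
  [/\ continuous (fun t => (F t).1.1.1), continuous (fun t => (F t).1.1.2),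
      continuous (fun t => (F t).1.2) & continuous (fun t => (F t).2)].
Proof.
move=> Fc.
have c1 (U V : topologicalType) (g : T -> (U * V)%type) : continuous g ->
    continuous (fun t => (g t).1) /\ continuous (fun t => (g t).2).
  move=> gc; split=> t; apply: continuous_comp (gc t) _.
    exact: cvg_fst.
  exact: cvg_snd.
have [a dC] := c1 _ _ _ Fc; have [b cC] := c1 _ _ _ a; have [aC bC] := c1 _ _ _ b.
by split.
Qed.

Lemma qmul_continuous F G : continuous F -> continuous G ->
  continuous (fun t => F t * G t)%quat.
Proof.
move=> /qcoord_continuous[F0 F1 F2 F3] /qcoord_continuous[G0 G1 G2 G3].
rewrite (_ : (fun t => _) = fun t =>
  ((F t).1.1.1 * (G t).1.1.1 - (F t).1.1.2 * (G t).1.1.2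
     - (F t).1.2 * (G t).1.2 - (F t).2 * (G t).2,
   (F t).1.1.1 * (G t).1.1.2 + (F t).1.1.2 * (G t).1.1.1
     + (F t).1.2 * (G t).2 - (F t).2 * (G t).1.2,
   (F t).1.1.1 * (G t).1.2 - (F t).1.1.2 * (G t).2
     + (F t).1.2 * (G t).1.1.1 + (F t).2 * (G t).1.1.2,
   (F t).1.1.1 * (G t).2 + (F t).1.1.2 * (G t).1.2
     - (F t).1.2 * (G t).1.1.2 + (F t).2 * (G t).1.1.1)); last first.
  by apply/funext => t; case: (F t) (G t) => [[[? ?] ?] ?] [[[? ?] ?] ?].
have cM (a b : T -> R) : continuous a -> continuous b -> continuous (fun t => a t * b t).
  by move=> ac bc t; exact: cvgM (ac t) (bc t).
have cD (a b : T -> R) : continuous a -> continuous b -> continuous (fun t => a t + b t).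
  by move=> ac bc t; exact: cvgD (ac t) (bc t).
have cB (a b : T -> R) : continuous a -> continuous b -> continuous (fun t => a t - b t).
  by move=> ac bc t; exact: cvgB (ac t) (bc t).
exact: (quat_continuous
  (cB _ _ (cB _ _ (cB _ _ (cM _ _ F0 G0) (cM _ _ F1 G1)) (cM _ _ F2 G2)) (cM _ _ F3 G3))
  (cB _ _ (cD _ _ (cD _ _ (cM _ _ F0 G1) (cM _ _ F1 G0)) (cM _ _ F2 G3)) (cM _ _ F3 G2))
  (cD _ _ (cD _ _ (cB _ _ (cM _ _ F0 G2) (cM _ _ F1 G3)) (cM _ _ F2 G0)) (cM _ _ F3 G1))
  (cD _ _ (cB _ _ (cD _ _ (cM _ _ F0 G3) (cM _ _ F1 G2)) (cM _ _ F2 G1)) (cM _ _ F3 G0))).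
Qed.

Lemma qinv_continuous F : continuous F -> continuous (fun t => (F t)^-1)%quat.
Proof.
move=> /qcoord_continuous[F0 F1 F2 F3].
rewrite (_ : (fun t => _) = fun t =>
  ((F t).1.1.1, - (F t).1.1.2, - (F t).1.2, - (F t).2)); last first.
  by apply/funext => t; case: (F t) => [[[? ?] ?] ?].
have cN (a : T -> R) : continuous a -> continuous (fun t => - a t).
  by move=> ac t; exact: cvgN (ac t).
exact: (quat_continuous F0 (cN _ F1) (cN _ F2) (cN _ F3)).
Qed.

Lemma qre_continuous F : continuous F -> continuous (fun t => qre (F t)).
Proof.
move=> /qcoord_continuous[F0 _ _ _]; rewrite (_ : (fun t => _) = fun t => (F t).1.1.1) //.
by apply/funext => t; case: (F t) => [[[? ?] ?] ?].
Qed.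

Lemma qexp_continuous (t : T -> R) Q : continuous t ->
  continuous (fun s => qexp (t s) Q).
Proof.
case: Q => [[[q0 q1] q2] q3] tc.
have ct : continuous (fun s => cos (t s)).
  by move=> s; apply: continuous_comp (tc s) _; exact: continuous_cos.
have st : continuous (fun s => sin (t s)).
  by move=> s; apply: continuous_comp (tc s) _; exact: continuous_sin.
have sq (q : R) : continuous (fun s => sin (t s) * q).
  by move=> s; apply: cvgM; [exact: st|exact: cvg_cst].
have c0 : continuous (fun s => cos (t s) + sin (t s) * q0).
  by move=> s; exact: cvgD (ct s) (sq q0 s).
exact: (quat_continuous c0 (sq q1) (sq q2) (sq q3)).
Qed.

End QuaternionContinuity.

(** * Traces of words as continuous functions on conjugacy classes *)

Section Traces.
Context {R : realType} {X : Type}.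
Implicit Types (A : set {ptws X -> quat R}) (w : word X).

Lemma eval_continuous w :
  continuous (fun x : {ptws X -> quat R} => Defs.eval x w).
Proof.
elim: w => [i||v IHv w IHw|v IHv] /=.
- exact: ptws_proj_continuous.
- exact: cst_continuous.
- exact: qmul_continuous.
- exact: qinv_continuous.
Qed.

Lemma eval_conj g (x y : {ptws X -> quat R}) w : SU2 g ->
  (forall i, y i = qconj g (x i)) -> Defs.eval y w = qconj g (Defs.eval x w).
Proof.
move=> gU yE; elim: w => [i||v IHv w IHw|v IHv] /=.
- exact: yE.
- by rewrite qconj_real.
- by rewrite IHv IHw qconjM.
- by rewrite IHv qconjV.
Qed.

Lemma rep_class_eq A (x y : A) : rep_class x = rep_class y <-> conjugate x y.
Proof. by split=> /eqmodP. Qed.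

(** Half the SU(2) trace, read off at a chosen representative; conjugation invariance makes the
    choice immaterial ([trace_wordE]). *)
Definition trace_word A w (u : rep_space A) : R :=
  qre (Defs.eval (set_val (repr u)) w).

Lemma conjugate_trace A w (x y : A) : conjugate x y ->
  qre (Defs.eval (set_val x) w) = qre (Defs.eval (set_val y) w).
Proof.
by move=> /asboolP[g gU yE]; rewrite (eval_conj w gU yE) qre_conj.
Qed.

Lemma trace_wordE A w (x : A) :
  trace_word w (rep_class x) = qre (Defs.eval (set_val x) w).
Proof.
apply/esym/conjugate_trace; apply/rep_class_eq.
by rewrite /rep_class reprK.
Qed.

Lemma trace_word_continuous A w : continuous (@trace_word A w).
Proof.
apply/quotient_continuous.
rewrite (_ : _ \o _ = fun x : A => qre (Defs.eval (set_val x) w)); last first.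
  by apply/funext => x; exact: trace_wordE.
move=> x; have := qre_continuous (@eval_continuous w) (x := set_val x).
exact: (continuous_comp (@set_val_continuous _ A x)).
Qed.

Lemma rep_class_continuous A : continuous (@rep_class R X A).
Proof. exact: pi_continuous. Qed.

End Traces.

Lemma card_set2 (T : Type) (x y : T) : x <> y -> ([set x; y] #= `I_2)%card.
Proof.
move=> xy; apply/eq_cardSP; exists x; first by left.
rewrite (_ : _ `\ x = [set y]); first exact: card_set1.
by apply/seteqP; split=> [z [[->|->]]|_ ->] //=; split; [right | exact/nesym].
Qed.

(** * The circle: compactness, descent of periodic maps, separation *)

Section Circle.
Context {R : realType}.

Lemma angle_eq (x y : R) : angle x = angle y <-> mod2pi x y.
Proof. by split=> /eqmodP. Qed.

Lemma mod2pi_repr (x : R) : mod2pi (repr (angle x)) x.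
Proof. by apply/angle_eq; rewrite /angle reprK. Qed.

Lemma angle_surj (u : circle R) : exists2 x, 0 <= x <= pi *+ 2 & angle x = u.
Proof.
have [x /andP[x0 x2] xu] := mod2pi_reduce (repr u).
exists x; first by rewrite x0 ltW.
by have /angle_eq -> := xu; rewrite /angle reprK.
Qed.

Lemma angle_continuous : continuous (@angle R).
Proof. exact: pi_continuous. Qed.

Lemma circle_compact : compact [set: circle R].
Proof.
rewrite (_ : setT = @angle R @` `[0, pi *+ 2]); last first.
  apply/seteqP; split=> // u _; have [x xI <-] := angle_surj u.
  by exists x; rewrite //= in_itv.
apply: continuous_compact; last exact: segment_compact.
by apply: continuous_subspaceT; exact: angle_continuous.
Qed.

Definition circle_lift (T : Type) (g : R -> T) (u : circle R) : T := g (repr u).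

Section Lift.
Variables (T : topologicalType) (g : R -> T).
Hypothesis gP : forall x y, mod2pi x y -> g x = g y.

Lemma circle_liftE x : circle_lift g (angle x) = g x.
Proof. exact/gP/mod2pi_repr. Qed.

Lemma circle_lift_continuous : continuous g -> continuous (circle_lift g).
Proof.
move=> gc; apply/quotient_continuous; rewrite (_ : _ \o _ = g) //.
by apply/funext => x; exact: circle_liftE.
Qed.

End Lift.

(** The usual unit circle in the plane, from which the quotient inherits the Hausdorff property. *)
Definition circle_embed : circle R -> (R * R)%type :=
  circle_lift (fun x => (cos x, sin x)).

Lemma circle_embedE (x : R) : circle_embed (angle x) = (cos x, sin x).
Proof.
rewrite /circle_embed circle_liftE // => s t st.
by rewrite (periodic_mod2pi (@cosD2pi R) st) (periodic_mod2pi (@sinD2pi R) st).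
Qed.

Lemma circle_embed_inj : injective circle_embed.
Proof.
move=> u v; have [x _ <-] := angle_surj u; have [y _ <-] := angle_surj v.
by rewrite !circle_embedE => -[cE sE]; apply/angle_eq/mod2pi_cos_sin.
Qed.

Lemma circle_embed_continuous : continuous circle_embed.
Proof.
apply: circle_lift_continuous => [s t st|x].
  by rewrite (periodic_mod2pi (@cosD2pi R) st) (periodic_mod2pi (@sinD2pi R) st).
exact: (cvg_pair (@continuous_cos R x) (@continuous_sin R x)).
Qed.

Lemma circle_hausdorff : hausdorff_space (circle R).
Proof.
apply: injective_hausdorff circle_embed_continuous circle_embed_inj.
exact: norm_hausdorff.
Qed.

End Circle.

(** * Closure properties of smooth functions *)

Section Smooth.
Context {R : realType}.
Implicit Types f g : R -> R.

Lemma derive1nD f g n : smooth f -> smooth g ->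
  (f + g)^`(n)%classic = f^`(n)%classic + g^`(n)%classic.
Proof.
move=> fS gS; elim: n => [|n IH]; first by rewrite !derive1n0.
rewrite !derive1nS IH; apply/funext => x.
by rewrite [RHS]/(_ + _) /= !derive1E deriveD //; [exact: fS | exact: gS].
Qed.

Lemma smoothD f g : smooth f -> smooth g -> smooth (f + g).
Proof.
by move=> fS gS x n; rewrite derive1nD //; apply: derivableD; [exact: fS|exact: gS].
Qed.

Lemma derive1nZ (k : R) f n : smooth f ->
  (k \*: f)^`(n)%classic = k \*: f^`(n)%classic.
Proof.
move=> fS; elim: n => [|n IH]; first by rewrite !derive1n0.
rewrite !derive1nS IH; apply/funext => x /=.
by rewrite !derive1E deriveZ //; exact: fS.
Qed.

Lemma smoothZ (k : R) f : smooth f -> smooth (k \*: f).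
Proof. by move=> fS x n; rewrite derive1nZ //; apply: derivableZ; exact: fS. Qed.

Lemma derive1_cst_fun (k : R) : (cst k : R -> R)^`()%classic = cst 0.
Proof. by apply/funext => x; rewrite derive1E derive_cst. Qed.

Lemma smooth_cst (k : R) : smooth (cst k).
Proof.
move=> x n; suff [c ->] : exists c, (cst k : R -> R)^`(n)%classic = cst c by [].
elim: n => [|n [c IH]]; first by exists k.
by exists 0; rewrite derive1nS IH derive1_cst_fun.
Qed.

Lemma smooth_id : smooth (id : R -> R).
Proof.
move=> x [|n]; first exact: derivable_id.
suff [c ->] : exists c, (id : R -> R)^`(n.+1)%classic = cst c by [].
elim: n => [|n [c IH]].
  by exists 1; apply/funext => y; rewrite derive1n1 derive1E derive_id.
by exists 0; rewrite derive1nS IH derive1_cst_fun.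
Qed.

Lemma smooth_continuous f : smooth f -> continuous f.
Proof.
move=> fS x; apply: differentiable_continuous; apply/derivable1_diffP.
exact: (fS x 0%N).
Qed.

End Smooth.

(** * Coordinates on the pillowcase *)

Section Pillow.
Context {R : realType}.
Implicit Types (gamma theta s t : R).

Lemma pillow_rep_mod2pi g t g' t' : mod2pi g g' -> mod2pi t t' ->
  pillow_rep g t = pillow_rep g' t' :> {ptws sphere_gen -> quat R}.
Proof.
have E (a b : R) : mod2pi a b -> cos a = cos b /\ sin a = sin b.
  by move=> ab; rewrite (periodic_mod2pi (@cosD2pi R) ab)
    (periodic_mod2pi (@sinD2pi R) ab).
move=> /E[cg sg] /E[ct st]; rewrite /pillow_rep /qexp.
by apply/funext => -[]; rewrite ?cosB ?sinB ?cg ?sg ?ct ?st.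
Qed.

Lemma pillow_pt_eq g t g' t' :
  pillow_rep g t = pillow_rep g' t' :> {ptws sphere_gen -> quat R} ->
  pillow_pt g t = pillow_pt g' t'.
Proof. by move=> E; rewrite /pillow_pt; congr rep_class; exact: val_inj. Qed.

Lemma pillow_pt_mod2pi g t g' t' : mod2pi g g' -> mod2pi t t' ->
  pillow_pt g t = pillow_pt g' t'.
Proof. by move=> *; apply/pillow_pt_eq/pillow_rep_mod2pi. Qed.

(** Conjugation by i sends k to - k and fixes i, so it reverses every angle. *)
Lemma pillow_ptN gamma theta :
  pillow_pt (- gamma) (- theta) = pillow_pt gamma theta.
Proof.
apply/rep_class_eq/asboolP; exists qi; first exact: Ci_SU2 Ci_qi.
have planarN (t : R) :
    (qexp t qk * qi)%quat = (qi * (qexp (- t) qk * qi) * qi^-1)%quat :> quat R.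
  by rewrite /= cosN sinN; congr (_, _, _, _); ring.
case; [|exact: planarN..|].
  by congr (_, _, _, _); ring.
rewrite -[RHS]/(qi * (qexp (- theta - - gamma) qk * qi) * qi^-1)%quat.
by rewrite -opprD -planarN.
Qed.

(** The real parts of a b and a c are - cos gamma and - cos theta. *)
Lemma pillow_pt_cos g t g' t' : pillow_pt g t = pillow_pt g' t' ->
  cos g = cos g' /\ cos t = cos t'.
Proof.
move=> E.
have := congr1 (trace_word (Gen Sa * Gen Sb)%word) E.
have := congr1 (trace_word (Gen Sa * Gen Sc)%word) E.
by rewrite !trace_wordE /= => *; split; lra.
Qed.

Lemma pillow_pt_continuous (T : topologicalType) (g t : T -> R) :
  continuous g -> continuous t -> continuous (fun x => pillow_pt (g x) (t x)).
Proof.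
move=> gc tc.
have c : continuous (fun x => pillow_rep (g x) (t x) : {ptws sphere_gen -> quat R}).
  have ci (h : T -> R) : continuous h -> continuous (fun x => qexp (h x) qk * qi)%quat.
    move=> hc; apply: qmul_continuous; first exact: qexp_continuous.
    exact: cst_continuous.
  apply: ptws_continuous; case.
  - exact: cst_continuous.
  - exact: ci.
  - exact: ci.
  - by apply: ci => x; exact: cvgB (tc x) (gc x).
have ec := @elt_continuous _ _ _ _ (fun x => pillow_repP (g x) (t x)) c.
by move=> x; exact: (continuous_comp (ec x) (@rep_class_continuous _ _ _ _)).
Qed.

Lemma corners_sin gamma theta : corners (pillow_pt gamma theta) ->
  sin gamma = 0 /\ sin theta = 0.
Proof.
have s0 (x : R) (m : int) : cos x = cos (m%:~R * pi) -> sin x = 0.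
  move=> cx; apply/eqP; rewrite -sqrf_eq0 sin2cos2 cx -sin2cos2.
  by rewrite sin_int_pi expr0n.
by move=> [m [n /pillow_pt_cos[/s0 ? /s0 ?]]].
Qed.

End Pillow.

(** * The moduli space as a circle *)

Section Moduli.
Context {R : realType} (f : R -> R).
Hypothesis f_smooth : smooth f.
Hypothesis f_odd : forall x : R, f (- x) = - f x.
Hypothesis f_periodic : periodic f (pi *+ 2).

Definition moduli_pt eps beta : moduli f eps :=
  rep_class (elt (standard_repP f_odd f_periodic eps beta)).

Definition moduli_param eps : circle R -> moduli f eps := circle_lift (moduli_pt eps).

Lemma moduli_pt_mod2pi eps s t : mod2pi s t -> moduli_pt eps s = moduli_pt eps t.
Proof.
move=> st; rewrite /moduli_pt; congr rep_class; apply: val_inj.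
exact: standard_rep_mod2pi.
Qed.

Lemma moduli_paramE eps beta : moduli_param eps (angle beta) = moduli_pt eps beta.
Proof. exact: circle_liftE (@moduli_pt_mod2pi eps) _. Qed.

Lemma moduli_pt_continuous eps : continuous (moduli_pt eps).
Proof.
have fc := smooth_continuous f_smooth.
have nc : continuous (fun beta => eps * f beta).
  by move=> x; exact: cvgM (cvg_cst _) (fc x).
have pc : continuous (fun beta => qexp (eps * f beta) (qk : quat R)).
  exact: qexp_continuous.
have hc : continuous (fun beta => standard_rep f eps beta Th).
  apply: qmul_continuous; last exact: cst_continuous.
  apply: qmul_continuous; first exact: cst_continuous.
  exact: qinv_continuous.
have bc : continuous (fun beta => standard_rep f eps beta Tb).
  apply: qmul_continuous; last exact: qinv_continuous.
  by apply: qexp_continuous => x; exact: cvg_id.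
have cc : continuous (fun beta => standard_rep f eps beta Tc).
  apply: qmul_continuous => //; apply: qmul_continuous => //.
  exact: qinv_continuous.
have sc : continuous (standard_rep f eps).
  apply: ptws_continuous; case; [exact: cst_continuous|exact: bc|exact: cc| |
    exact: hc|exact: cst_continuous|exact: pc].
  apply: qmul_continuous; last exact: cst_continuous.
  by apply: qmul_continuous => //; exact: qinv_continuous.
have ec := @elt_continuous _ _ _ _ (standard_repP f_odd f_periodic eps) sc.
by move=> x; exact: (continuous_comp (ec x) (@rep_class_continuous _ _ _ _)).
Qed.

Lemma moduli_param_continuous eps : continuous (moduli_param eps).
Proof.
exact: circle_lift_continuous (@moduli_pt_mod2pi eps) (@moduli_pt_continuous eps).
Qed.

(** On [standard_rep], a p^-1 h = u (u k) = - k, so this word evaluates to - e^(beta k) k, whose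
    real part is sin beta. *)
Definition circle_word : word tangle_gen :=
  (Gen Tb * Gen Th * Gen Ta * (Gen Tp)^-1 * Gen Th)%word.

Definition moduli_embed eps (u : moduli f eps) : (R * R)%type :=
  (trace_word longitudeP u, trace_word circle_word u).

Lemma moduli_embed_continuous eps : continuous (@moduli_embed eps).
Proof.
move=> u; exact: (cvg_pair (@trace_word_continuous _ _ _ longitudeP u)
  (@trace_word_continuous _ _ _ circle_word u)).
Qed.

Lemma moduli_embedE eps beta :
  moduli_embed (moduli_pt eps beta) = (cos beta, sin beta).
Proof.
rewrite /moduli_embed !trace_wordE; set nu := eps * f beta.
pose x := standard_rep f eps beta.
have hU : SU2 (x Th).
  by have [[xU _] _ _ _] := standard_repP f_odd f_periodic eps beta; exact: xU.
have bhE : (x Tb * x Th)%quat = qexp beta qk.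
  rewrite -[x Tb]/(qexp beta (qk : quat R) * (x Th)^-1)%quat -qmulA.
  by rewrite qmulVq ?qmulq1.
congr (_, _).
  by rewrite -[Defs.eval _ _]/(x Tb * x Th)%quat bhE /= mulr0 addr0.
rewrite -[Defs.eval _ _]/(x Tb * x Th * x Ta * (x Tp)^-1 * x Th)%quat bhE.
rewrite -!qmulA [(x Ta * _)%quat]qmulA.
have -> : (x Ta * (x Tp)^-1 * x Th)%quat = (qscale (-1) qk : quat R).
  rewrite /x /standard_rep -/nu /=; congr (_, _, _, _); ring: (cos2sin2 nu).
by rewrite /=; ring.
Qed.

Lemma restriction_moduli_pt eps beta : restriction (moduli_pt eps beta) =
  pillow_pt (beta + eps * f beta + pi / 2) (beta - eps * f beta + pi / 2).
Proof.
rewrite /moduli_pt restriction_class /pillow_pt; congr rep_class.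
by apply: val_inj; exact: standard_rep_boundary.
Qed.

Hypothesis f_le1 : forall x : R, `|f x| <= 1.
Hypothesis f_neq0 : forall x : R, (forall m : int, x <> m%:~R * pi) -> f x <> 0.

Lemma moduli_param_surj eps (u : moduli f eps) : 0 < eps < 1 ->
  exists c, moduli_param eps c = u.
Proof.
move=> eE; set x := repr u.
have [beta [a [Q [aC QC aQ xE]]]] :=
  tangle_rep_frame f_odd f_le1 f_neq0 eE (set_valP x).
have [g gU [ga gQ]] := Ci_frame aC QC aQ.
exists (angle beta); rewrite moduli_paramE -[RHS]reprK.
apply/esym/rep_class_eq/asboolP; exists g => // i.
apply: etrans (congr1 (qconj g) (esym (xE i))).
rewrite -tangle_frame_conj // ga gQ; exact: erefl.
Qed.

(** By surjectivity of the parametrization, only standard points need comparing, and these depend on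
    beta modulo 2 pi alone. *)
Lemma moduli_embed_inj eps : 0 < eps < 1 -> injective (@moduli_embed eps).
Proof.
move=> eE u v; have [c <-] := moduli_param_surj u eE.
have [d <-] := moduli_param_surj v eE.
have [s _ <-] := angle_surj c; have [t _ <-] := angle_surj d.
rewrite !moduli_paramE !moduli_embedE => -[cE sE].
exact/moduli_pt_mod2pi/mod2pi_cos_sin.
Qed.

Lemma moduli_param_inj eps : injective (moduli_param eps).
Proof.
move=> u v; have [s _ <-] := angle_surj u; have [t _ <-] := angle_surj v.
rewrite !moduli_paramE => /(congr1 (@moduli_embed eps)).
by rewrite !moduli_embedE => -[cE sE]; apply/angle_eq/mod2pi_cos_sin.
Qed.

Lemma moduli_param_homeomorphism eps : 0 < eps < 1 -> homeomorphism (moduli_param eps).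
Proof.
move=> eE; apply: compact_homeomorphism.
- exact: circle_compact.
- apply: injective_hausdorff (@moduli_embed_continuous eps) (moduli_embed_inj eE).
  exact: norm_hausdorff.
- exact: moduli_param_continuous.
- exact: moduli_param_inj.
- by move=> u; exact: moduli_param_surj.
Qed.

(** * The restriction map: corners and immersion *)

Lemma restriction_not_corner eps beta : 0 < eps < 1 ->
  ~ corners (pillow_pt (beta + eps * f beta + pi / 2) (beta - eps * f beta + pi / 2)).
Proof.
move=> eE /corners_sin[]; rewrite !sinDpihalf => c1 c2.
(* Both cos (beta + nu) and cos (beta - nu) vanish, so the sine of the difference of these angles
   does too. *)
have s2 : sin (2 * (eps * f beta)) = 0.
  rewrite (_ : 2 * _ = (beta + eps * f beta) - (beta - eps * f beta)); last by ring.
  by rewrite sinB c1 c2 mulr0 mul0r subr0.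
have n0 : 2 * (eps * f beta) = 0.
  by apply: sin_small_eq0 => //; apply: normM_small => //; rewrite ger0_norm //; lra.
have f0 : eps * f beta = 0 by lra.
have [sb|/(perturbation_neq0 f_le1 f_neq0 eE)] := pselect (sin beta = 0).
  have := cos2Dsin2 beta; rewrite sb; move: c1; rewrite f0 addr0 => ->.
  by rewrite expr0n addr0 => /eqP; rewrite eq_sym oner_eq0.
by rewrite f0 sin0.
Qed.

Lemma restriction_immersion eps : 0 < eps < 1 ->
  pillow_immersion (@restriction R f eps \o moduli_param eps).
Proof.
move=> eE t; rewrite /comp moduli_paramE restriction_moduli_pt.
split; first exact: restriction_not_corner.
pose path (k : R) : R -> R := id + (k \*: f) + cst (pi / 2).
have pathS k : smooth (path k).
  apply: smoothD; last exact: smooth_cst.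
  by apply: smoothD; [exact: smooth_id|exact: smoothZ].
have df : derivable f t 1 by exact: (@f_smooth t 0%N).
have path' k : (path k)^`()%classic t = 1 + k * f^`()%classic t.
  rewrite !derive1E /path deriveD; last exact: derivable_cst.
    rewrite deriveD; [|exact: derivable_id|exact: derivableZ].
    by rewrite derive_id deriveZ // derive_cst addr0.
  by apply: derivableD; [exact: derivable_id|exact: derivableZ].
exists (path eps), (path (- eps)); split; last first.
  (* The two derivatives are 1 + eps f' and 1 - eps f', with sum 2. *)
  by rewrite !path' => -[]; lra.
apply: (filterS _ (@filterT _ (nbhs t) _)) => s _; split; [exact: pathS|exact: pathS|].
rewrite moduli_paramE restriction_moduli_pt; congr pillow_pt.
by rewrite [RHS]/(s + - eps * f s + pi / 2) mulNr.
Qed.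

(** * The limit as eps tends to 0 *)

Definition limit_param : circle R -> pillowcase R :=
  circle_lift (fun beta => pillow_pt (beta + pi / 2) (beta + pi / 2)).

Lemma limit_paramE beta :
  limit_param (angle beta) = pillow_pt (beta + pi / 2) (beta + pi / 2).
Proof.
by rewrite /limit_param circle_liftE // => s t /mod2piD st; exact: pillow_pt_mod2pi.
Qed.

Lemma limit_param_continuous : continuous limit_param.
Proof.
apply: circle_lift_continuous => [s t /mod2piD st|].
  exact: pillow_pt_mod2pi.
by apply: pillow_pt_continuous => x; exact: cvgD cvg_id (cvg_cst _).
Qed.

(** A tube argument: the family is one jointly continuous map [G] of (beta, eps), so an open
    condition on a compact set of angles at eps = 0 persists for small eps. *)
Lemma restriction_cvg :
  {compact-open, (fun eps : R => @restriction R f eps \o moduli_param eps)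
     @ 0^'+ --> limit_param}.
Proof.
apply/compact_open_cvgP => K O Kc oO KO.
pose G (y : R * R) := pillow_pt (y.1 + y.2 * f y.1 + pi / 2) (y.1 - y.2 * f y.1 + pi / 2).
have Gc : continuous G.
  have nc : continuous (fun y : R * R => y.2 * f y.1).
    move=> y; apply: cvgM; first exact: cvg_snd.
    apply: (continuous_comp (@cvg_fst _ _ _ _ _)); exact: smooth_continuous.
  apply: pillow_pt_continuous => y; apply: cvgD (cvg_cst _).
    by apply: cvgD (nc y); exact: cvg_fst.
  by apply: cvgB (nc y); exact: cvg_fst.
(* A compact lift of K to one closed period; K is closed because the circle is Hausdorff. *)
pose L := [set x : R | 0 <= x <= pi *+ 2 /\ K (angle x)].
have Lc : compact L.
  rewrite (_ : L = `[0, pi *+ 2] `&` @angle R @^-1` K); last first.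
    by apply/seteqP; split=> x /=; rewrite in_itv.
  apply: compact_closedI; first exact: segment_compact.
  apply: closed_comp => [x _|]; first exact: angle_continuous.
  exact: compact_closed circle_hausdorff Kc.
have : \forall e \near (0 : R)^'+, L `<=` (fun x => O (G (x, e))).
  move/compact_near_coveringP: Lc; apply => x [_ Kx].
  have : nbhs (x, 0 : R) (G @^-1` O).
    apply: Gc; apply: open_nbhs_nbhs; split=> //; apply: KO; exists (angle x) => //.
    by rewrite limit_paramE /G /= mul0r subr0 addr0.
  move=> [[A B] /= [xA B0] AB]; exists (A, B) => //=; split=> //.
  exact: cvg_within.
apply: filterS => e Le _ [u Ku <-].
have [x xI xu] := angle_surj u.
rewrite -xu /comp moduli_paramE restriction_moduli_pt.
by apply: (Le x); split=> //; rewrite xu.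
Qed.

Lemma limit_param_range : range limit_param = diagonal_arc R.
Proof.
apply/seteqP; split=> [_ [u _ <-]|_ [t _ ->]]; last first.
  by exists (angle (t - pi / 2)) => //; rewrite limit_paramE subrK.
have [x _ <-] := angle_surj u; rewrite limit_paramE.
have [y /andP[y0 y2] yx] := mod2pi_reduce (x + pi / 2).
rewrite -(pillow_pt_mod2pi yx yx).
have [yp|py] := leP y pi; first by exists y; rewrite // y0.
(* Angles beyond pi are folded back by the sign symmetry combined with one period. *)
exists (pi *+ 2 - y).
  by move: y2 py; rewrite mulr2n => *; apply/andP; split; lra.
rewrite -pillow_ptN; apply: pillow_pt_mod2pi; apply/asboolP; exists 1; ring.
Qed.

(** The cosine of x + pi / 2 is an invariant of the image, so x + pi / 2 is t or - t modulo 2 pi. *)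
Lemma limit_param_fiber t :
  limit_param @^-1` [set pillow_pt t t] = [set angle (t - pi / 2); angle (- t - pi / 2)].
Proof.
apply/seteqP; split=> [u|_ [->|->]] /=; last 2 first.
  by rewrite limit_paramE subrK.
  by rewrite limit_paramE subrK pillow_ptN.
have [x _ <-] := angle_surj u; rewrite limit_paramE => /pillow_pt_cos[cE _].
have : (sin (x + pi / 2) - sin t) * (sin (x + pi / 2) + sin t) = 0.
  have := cos2Dsin2 (x + pi / 2); have := cos2Dsin2 t; rewrite cE => h1 h2.
  by rewrite -subr_sqr; lra.
move/eqP; rewrite mulf_eq0 subr_eq0 addr_eq0 => /orP[] /eqP sE; [left|right];
  rewrite -[x in LHS](addrK (pi / 2)); apply/angle_eq/mod2piD/mod2pi_cos_sin;
  by rewrite ?cosN ?sinN.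
Qed.

Lemma limit_param_2to1 : generically_2to1_onto limit_param (diagonal_arc R).
Proof.
split; first exact: limit_param_range.
(* Only over the two ends of the arc can the two preimages coincide: for 0 < t < pi, sin t differs
   from sin (- t). *)
apply: sub_finite_set (finite_set2 (pillow_pt 0 0) (pillow_pt pi pi)).
move=> _ [[t /andP[t0 tp] ->] /= bad]; move: t0 tp.
rewrite le_eqVlt => /predU1P[<-|t0]; first by left.
rewrite le_eqVlt => /predU1P[->|tp]; first by right.
case: bad; rewrite limit_param_fiber; apply: card_set2 => /angle_eq/mod2piD.
move=> /(_ (pi / 2)); rewrite !subrK => tt.
have := periodic_mod2pi (@sinD2pi R) tt; rewrite sinN.
have : 0 < sin t by apply: sin_gt0_pi; rewrite t0.
by lra.
Qed.

End Moduli.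

Theorem theorem1 (R : realType) (f : R -> R) (f_smooth : smooth f)
  (f_odd : forall x : R, f (- x) = - f x)
  (f_periodic : periodic f (pi *+ 2))
  (f_le1 : forall x : R, `|f x| <= 1)
  (f_neq0 : forall x : R, (forall m : int, x <> m%:~R * pi) -> f x <> 0) :
  exists Phi : forall eps : R, circle R -> moduli f eps,
    (exists2 eps0 : R, 0 < eps0 & forall eps : R, 0 < eps < eps0 ->
      [/\ homeomorphism (Phi eps),
          pillow_immersion (@restriction R f eps \o Phi eps) &
          forall beta : R, restriction (Phi eps (angle beta)) =
            pillow_pt (beta + eps * f beta + pi / 2)
                      (beta - eps * f beta + pi / 2)]) /\
    (exists rho0 : circle R -> pillowcase R,
      [/\ continuous rho0,
          {compact-open, (fun eps : R => @restriction R f eps \o Phi eps)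
             @ 0^'+ --> rho0} &
          generically_2to1_onto rho0 (diagonal_arc R)]).
Proof.
exists (moduli_param f_odd f_periodic); split.
  exists 1 => // eps eE; split.
  - exact: moduli_param_homeomorphism.
  - exact: restriction_immersion.
  - by move=> beta; rewrite moduli_paramE restriction_moduli_pt.
exists limit_param; split.
- exact: limit_param_continuous.
- exact: restriction_cvg.
- exact: limit_param_2to1.
Qed.
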